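(* Let $\mathcal{R}$ be a predicative recursive TRS. Then the innermost derivation height of any basic term $f(u_1,\dots,u_k;\, v_1,\dots,v_l)$ is bounded by a polynomial in the maximal depth of the normal arguments $u_1,\dots,u_k$. The polynomial depends only on $\mathcal{R}$ and the signature $\mathcal{F}$. In particular, the (innermost) runtime complexity of $\mathcal{R}$ is polynomial.
   Context: Fix a countably infinite set of variables $\mathcal{V}$ and a finite signature $\mathcal{F}$ partitioned into defined symbols $\mathcal{D}$ and constructors $\mathcal{C}$. Values are terms built from constructors and variables; basic terms are variables or terms $f(v_1,\dots,v_n)$ with $f\in\mathcal{D}$ and all $v_i$ values. The depth is $\mathrm{depth}(x)=1$ for variables and $\mathrm{depth}(f(t_1,\dots,t_n))=1+\max_i \mathrm{depth}(t_i)$ (maximum of the empty set is $0$). A TRS is a constructor TRS if all left-hand sides are basic terms. The innermost rewrite relation $\xrightarrow{i}_{\mathcal{R}}$ only rewrites redexes whose arguments are normal forms; the innermost derivation height of $s$ is the maximal length of an innermost derivation starting from $s$, and the runtime complexity $\mathrm{rc}_{\mathcal{R}}(n)$ is the maximal innermost derivation height of a basic term of size at most $n$. A safe mapping assigns to each function symbol a set of safe argument positions (the others are normal); for constructors all positions are safe. We write $f(s_1,\dots,s_k;\,s_{k+1},\dots,s_{k+l})$ with the first $k$ positions normal and the remaining $l$ safe. A precedence is a preorder $\succcurlyeq$ on $\mathcal{F}$ with strict part $\succ$ and equivalence $\approx$; it is admissible if $f\approx g$ implies that $f,g$ are both defined or both constructors. Safe equivalence $\approx_s$: $s\approx_s t$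 if $s=t$, or $s=f(s_1,\dots,s_n)$, $t=g(t_1,\dots,t_n)$, $f\approx g$ and for some permutation $\pi$, $s_i\approx_s t_{\pi(i)}$ and ($i$ safe for $f$ iff $\pi(i)$ safe for $g$) for all $i$. For $F\subseteq\mathcal{F}$ let $F_{\downarrow}=\{g\mid f\succ g \text{ for some } f\in F\}$, and $\mathrm{Fun}(s)$ the set of symbols in $s$. Auxiliary order $\sqsupset$: for $s=f(s_1,\dots,s_k;s_{k+1},\dots,s_{k+l})$, $s\sqsupset t$ if (1) $s_i \sqsupset t$ or $s_i\approx_s t$ for some $i$, where $i\le k$ (normal) if $f\in\mathcal{D}$; or (2) $f\in\mathcal{D}$, $t=g(t_1,\dots,t_{m+n})$, $f\succ g$ and $s\sqsupset t_i$ for all $i$. Polynomial path order $>_{\mathrm{pop*}}$ (with $\geqslant_{\mathrm{pop*}} = {>_{\mathrm{pop*}}}\cup{\approx_s}$): for $s=f(s_1,\dots,s_k;s_{k+1},\dots,s_{k+l})$, $s>_{\mathrm{pop*}} t$ if (1) $s_i\geqslant_{\mathrm{pop*}} t$ for some $i\in\{1,\dots,k+l\}$; or (2) $f\in\mathcal{D}$, $t=g(t_1,\dots,t_m;t_{m+1},\dots,t_{m+n})$, $f\succ g$, $s\sqsupset t_j$ for all normal $j\le m$, $s>_{\mathrm{pop*}} t_j$ for all safe $j>m$, and $t_j\notin\mathcal{T}(\mathrm{Fun}(s)_{\downarrow},\mathcal{V})$ for at most one safe position $j$; or (3) $f\in\mathcal{D}$, $t=g(t_1,\dots,t_m;t_{m+1},\dots,t_{m+n})$,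 $f\approx g$, the multiset $\{s_1,\dots,s_k\}$ is greater than $\{t_1,\dots,t_m\}$ in the strict multiset extension of $>_{\mathrm{pop*}}$ (modulo $\approx_s$), and $\{s_{k+1},\dots,s_{k+l}\}$ is greater than or equal to $\{t_{m+1},\dots,t_{m+n}\}$ in the weak multiset extension of $\geqslant_{\mathrm{pop*}}$. A (finite) constructor TRS $\mathcal{R}$ is predicative recursive if $l>_{\mathrm{pop*}} r$ for all rules $l\to r\in\mathcal{R}$, for some instance of $>_{\mathrm{pop*}}$ based on an admissible precedence and a safe mapping.
   Formalization: Admissibility of the precedence additionally requires that no constructor is strictly above a defined symbol; otherwise f(c(x);) → g(; f(x;), f(x;)) with c ≻ f ≻ g is oriented although its runtime is exponential. *)

(* Defs.v *)
From HB Require Import structures.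
From mathcomp Require Import all_boot all_order all_algebra.

Set Implicit Arguments.
Unset Strict Implicit.
Unset Printing Implicit Defensive.

(* The constructors are the symbols outside [defined]. *)
Record signature := Signature {
  symbol :> finType;
  arity : symbol -> nat;
  defined : {set symbol}
}.
Arguments defined : clear implicits.

Definition infinite_type (V : eqType) : Prop :=
  forall s : seq V, exists x : V, x \notin s.

Unset Elimination Schemes.
Inductive term (V : Type) (S : signature) : Type :=
| Var of V
| App (f : S) of {ffun 'I_(arity f) -> term V S}.
Set Elimination Schemes.
Arguments Var {V S} x.
Arguments App {V S} f a.

Notation args V S f := {ffun 'I_(@arity S f) -> term V S}.

Lemma term_rect (V : Type) (S : signature) (P : term V S -> Type) :
  (forall x, P (Var x)) ->
  (forall f (a : args V S f),
     (forall i, P (a i)) -> P (App f a)) ->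
  forall t, P t.
Proof.
by move=> PVar PApp; fix IH 1 => -[x|f a]; [apply: PVar | apply: PApp => i; apply: IH].
Defined.

Definition term_ind (V : Type) (S : signature) (P : term V S -> Prop) :=
  @term_rect V S P.

(* An injection into an eqType, used only to equip [term V S] with its
   (Leibniz) boolean equality. *)
Fixpoint term_code (V : countType) (S : signature) (t : term V S) :
    GenTree.tree (V + S) :=
  match t with
  | Var x => GenTree.Leaf (inl x)
  | App f a =>
      GenTree.Node 0 (GenTree.Leaf (inr f) ::
                      [seq term_code (a i) | i <- enum 'I_(arity f)])
  end.

Lemma term_code_inj (V : countType) (S : signature) :
  injective (@term_code V S).
Proof.
elim=> [x|f a IH] [y|g b] //= [].
  by move=> ->.
move=> efg; case: g / efg b => b /eq_in_map eab.
by congr App; apply/ffunP => i; apply: IH; apply: eab; rewrite mem_enum.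
Qed.

HB.instance Definition _ (V : countType) (S : signature) :=
  hasDecEq.Build (term V S) (inj_eqAxiom (@term_code_inj V S)).

Section Terms.
Context {V : countType} {S : signature}.
Implicit Types (s t u : term V S).

Fixpoint depth t : nat :=
  match t with
  | Var _ => 1
  | App f a => (\max_(i < arity f) depth (a i)).+1
  end.

Fixpoint tsize t : nat :=
  match t with
  | Var _ => 1
  | App f a => (\sum_(i < arity f) tsize (a i)).+1
  end.

Fixpoint Fun t : {set S} :=
  match t with
  | Var _ => set0
  | App f a => f |: \bigcup_(i < arity f) Fun (a i)
  end.

Fixpoint occurs (x : V) t : bool :=
  match t with
  | Var y => x == y
  | App f a => [exists i, occurs x (a i)]
  end.

Fixpoint subst (sigma : V -> term V S) t : term V S :=
  match t with
  | Var x => sigma x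
  | App f a => App f [ffun i => subst sigma (a i)]
  end.

Definition terms_over (G : {set S}) t : bool := Fun t \subset G.

Definition value t : bool := terms_over (~: defined S) t.

Definition basic t : bool :=
  match t with
  | Var _ => true
  | App f a => (f \in defined S) && [forall i, value (a i)]
  end.

End Terms.

(* A finite TRS is given by the list of its rules (l, r). *)
Definition trs (V : countType) (S : signature) := seq (term V S * term V S).

Section Rewriting.
Context {V : countType} {S : signature}.
Variable R : trs V S.
Implicit Types (s t u : term V S).

Definition is_var t : bool := if t is Var _ then true else false.

Definition constructor_trs : Prop :=
  forall l r, (l, r) \in R ->
    [/\ ~~ is_var l,
        forall x, occurs x r -> occurs x l
      & basic l].

Definition replace_arg (f : S) (a : args V S f)
    (i : 'I_(arity f)) t : args V S f :=
  [ffun j => if j == i then t else a j].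

Inductive rstep : term V S -> term V S -> Prop :=
| rstep_root l r sigma :
    (l, r) \in R -> rstep (subst sigma l) (subst sigma r)
| rstep_arg f (a : args V S f) i t :
    rstep (a i) t -> rstep (App f a) (App f (replace_arg a i t)).

Definition normal_form t : Prop := forall u, ~ rstep t u.

Inductive istep : term V S -> term V S -> Prop :=
| istep_root l r sigma f (a : args V S f) :
    (l, r) \in R -> subst sigma l = App f a ->
    (forall i, normal_form (a i)) ->
    istep (App f a) (subst sigma r)
| istep_arg f (a : args V S f) i t :
    istep (a i) t -> istep (App f a) (App f (replace_arg a i t)).

Fixpoint iderivation (n : nat) s t : Prop :=
  if n is m.+1 then exists2 u, istep s u & iderivation m u t else s = t.

(* [m] is the maximum of [P], the maximum of the empty set being 0;
   no [m] qualifies when [P] is unbounded. *)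
Definition is_max (P : nat -> Prop) (m : nat) : Prop :=
  (forall k, P k -> k <= m) /\ (P m \/ (forall k, ~ P k) /\ m = 0).

Definition is_dheight s (h : nat) : Prop :=
  is_max (fun n => exists t, iderivation n s t) h.

(* [rc(n) = m]; the first conjunct ensures that no basic term of infinite
   derivation height is silently discarded from the maximum. *)
Definition is_rc (n m : nat) : Prop :=
  (forall t, basic t -> tsize t <= n -> exists h, is_dheight t h) /\
  is_max (fun h => exists t, [/\ basic t, tsize t <= n & is_dheight t h]) m.

End Rewriting.

(* [safe f] is the set of safe positions of [f]. *)
Definition safe_assignment (S : signature) :=
  forall f : S, {set 'I_(arity f)}.

Definition safe_mapping (S : signature) (safe : safe_assignment S) : Prop :=
  forall f : S, f \notin defined S -> safe f = setT.

Section Precedence.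
Context {S : signature}.
Variable prec : rel S.

Definition precedence : Prop := reflexive prec /\ transitive prec.

Definition prec_gt : rel S := fun f g => prec f g && ~~ prec g f.
Definition prec_eq : rel S := fun f g => prec f g && prec g f.

(* The second conjunct (constructors do not dominate defined symbols) is
   needed because [down (Fun s)] below also collects what lies below the
   constructors of [s].  With c > f > g, f defined, c and g constructors, the
   rule f(c(x);) -> g(; f(x;), f(x;)) would otherwise be oriented, although
   its runtime complexity is exponential. *)
Definition admissible : Prop :=
  (forall f g, prec_eq f g -> (f \in defined S) = (g \in defined S)) /\
  (forall f g, f \notin defined S -> g \in defined S -> ~~ prec_gt f g).

Definition down (G : {set S}) : {set S} :=
  [set g | [exists f in G, prec_gt f g]].

End Precedence.

(* Multiset extensions, modulo [eqv], of [gt]; multisets are lists up to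
   [perm_eq]. *)
Section Multiset.
Variables (T : eqType) (gt eqv : T -> T -> Prop).

Inductive pairwise_eqv : seq T -> seq T -> Prop :=
| pairwise_eqv_nil : pairwise_eqv [::] [::]
| pairwise_eqv_cons x y X Y :
    eqv x y -> pairwise_eqv X Y -> pairwise_eqv (x :: X) (y :: Y).

Definition mul_ge (M N : seq T) : Prop :=
  exists X Y Z W : seq T,
    [/\ perm_eq M (X ++ Z), perm_eq N (Y ++ W), pairwise_eqv Z W
      & forall y, y \in Y -> exists2 x, x \in X & gt x y].

Definition mul_gt (M N : seq T) : Prop :=
  exists X Y Z W : seq T,
    [/\ X <> [::], perm_eq M (X ++ Z), perm_eq N (Y ++ W), pairwise_eqv Z W
      & forall y, y \in Y -> exists2 x, x \in X & gt x y].

End Multiset.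

Section PolynomialPathOrder.
Context {V : countType} {S : signature}.
Variables (prec : rel S) (safe : safe_assignment S).
Implicit Types (s t u : term V S) (f g : S).

Definition safe_args f (a : args V S f) :
    seq (term V S) := [seq a i | i <- enum (safe f)].
Definition normal_args f (a : args V S f) :
    seq (term V S) := [seq a i | i <- enum (~: safe f)].

Inductive safe_eq : term V S -> term V S -> Prop :=
| safe_eq_refl s : safe_eq s s
| safe_eq_App f g (a : args V S f) (b : args V S g)
    (pi : 'I_(arity f) -> 'I_(arity g)) :
    prec_eq prec f g -> bijective pi ->
    (forall i, safe_eq (a i) (b (pi i))) ->
    (forall i, (i \in safe f) = (pi i \in safe g)) ->
    safe_eq (App f a) (App g b).

Inductive aux_gt : term V S -> term V S -> Prop :=
| aux_gt_sub f (a : args V S f) i t :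
    (f \in defined S -> i \notin safe f) ->
    aux_gt (a i) t \/ safe_eq (a i) t ->
    aux_gt (App f a) t
| aux_gt_prec f (a : args V S f) g (b : args V S g) :
    f \in defined S -> prec_gt prec f g ->
    (forall i, aux_gt (App f a) (b i)) ->
    aux_gt (App f a) (App g b).

Inductive pop : term V S -> term V S -> Prop :=
| pop_sub f (a : args V S f) i t :
    pop (a i) t \/ safe_eq (a i) t ->
    pop (App f a) t
| pop_prec f (a : args V S f) g (b : args V S g) :
    f \in defined S -> prec_gt prec f g ->
    (forall j, j \notin safe g -> aux_gt (App f a) (b j)) ->
    (forall j, j \in safe g -> pop (App f a) (b j)) ->
    #|[set j in safe g
        | ~~ terms_over (down prec (Fun (App f a))) (b j)]| <= 1 ->
    pop (App f a) (App g b)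
| pop_mul f (a : args V S f) g (b : args V S g) :
    f \in defined S -> prec_eq prec f g ->
    mul_gt pop safe_eq (normal_args a) (normal_args b) ->
    mul_ge pop safe_eq (safe_args a) (safe_args b) ->
    pop (App f a) (App g b).

Definition normal_depth f (a : args V S f) : nat :=
  \max_(i < arity f | i \notin safe f) depth (a i).

End PolynomialPathOrder.

Section PredicativeRecursive.
Context {V : countType} {S : signature}.
Variable R : trs V S.

Definition pop_instance (prec : rel S) (safe : safe_assignment S) : Prop :=
  [/\ precedence prec, admissible prec, safe_mapping safe
    & forall l r, (l, r) \in R -> pop prec safe l r].

Definition predicative_recursive : Prop :=
  constructor_trs R /\ exists prec safe, pop_instance prec safe.

End PredicativeRecursive.

(* Main.v *)
Require Import Defs.
From HB Require Import structures.
From mathcomp Require Import all_boot all_order all_algebra.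
From mathcomp Require Import zify.
From Stdlib Require Import Classical_Prop.

Set Implicit Arguments.
Unset Strict Implicit.
Unset Printing Implicit Defensive.

(** Evaluate terms innermost and bound at once the cost of an evaluation and the
    depth of its result.  For a function symbol f whose normal arguments have
    depth at most N and whose safe arguments have depth at most M, the claim is
    that the cost is at most C(N) and the depth of the result at most D(N) + M,
    with C and D polynomial: safe arguments never influence the cost and
    contribute additively to the depth.  This is shown by induction along the
    precedence.  A right-hand side contains at most one call to a symbol
    equivalent to f, at a safe position; the multiset of depths of its normal
    arguments is smaller than that of the left-hand side, and there are only
    polynomially many multisets of bounded size over {1, ..., N}.  Everything
    else in the right-hand side is built from smaller symbols, whose normal
    arguments have depth polynomial in N because the auxiliary order sees only
    the normal arguments of the left-hand side.  The bounds depend on the maximal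
    arity, the maximal depth of a right-hand side and the number of symbols
    alone, hence are uniform in the precedence and in the safe mapping. *)

(** * Maxima of bounded predicates and polynomial bounds *)

Lemma ex_is_max (P : nat -> Prop) (B : nat) :
  (forall k, P k -> k <= B) -> exists2 m, is_max P m & m <= B.
Proof.
elim: B P => [|B IH] P leB.
  exists 0 => //; split=> //.
  case: (classic (P 0)) => [|nP0]; [by left | right; split=> // k Pk].
  by have := leB k Pk; rewrite leqn0 => /eqP k0; rewrite k0 in Pk.
case: (classic (P B.+1)) => [PB|nPB]; first by exists B.+1 => //; split=> //; left.
have [|m Pm mB] := IH P; last by exists m => //; apply: leqW.
move=> k Pk; have := leB k Pk; rewrite leq_eqVlt => /orP[/eqP kB|//].
by rewrite kB in Pk.
Qed.

(** The coefficients are natural numbers, so the bounding polynomials are monotone; this is what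
    makes the class closed under composition although [F] itself need not be monotone. *)
Definition poly_bounded (F : nat -> nat) : Prop :=
  exists p : {poly nat}, forall n, F n <= (p.[n])%R.

Lemma leq_horner (p : {poly nat}) m n : m <= n -> (p.[m])%R <= (p.[n])%R.
Proof.
move=> mn; rewrite !horner_coef; apply: leq_sum => i _.
apply: leq_mul => //; rewrite !natrXE.
by case: (nat_of_ord i) => [|k] //; rewrite leq_exp2r.
Qed.

Lemma poly_bounded_const k : poly_bounded (fun=> k).
Proof. by exists k%:P%R => n; rewrite hornerC. Qed.

Lemma poly_bounded_id : poly_bounded id.
Proof. by exists 'X%R => n; rewrite hornerX. Qed.

Lemma poly_bounded_add F G :
  poly_bounded F -> poly_bounded G -> poly_bounded (fun n => F n + G n).
Proof.
by move=> [p pF] [q qG]; exists (p + q)%R => n; rewrite hornerD; apply: leq_add.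
Qed.

Lemma poly_bounded_mul F G :
  poly_bounded F -> poly_bounded G -> poly_bounded (fun n => F n * G n).
Proof.
by move=> [p pF] [q qG]; exists (p * q)%R => n; rewrite hornerM; apply: leq_mul.
Qed.

Lemma poly_bounded_comp F G :
  poly_bounded F -> poly_bounded G -> poly_bounded (fun n => F (G n)).
Proof.
move=> [p pF] [q qG]; exists (p \Po q)%R => n; rewrite horner_comp.
by apply: leq_trans (pF _) _; apply: leq_horner.
Qed.

Lemma poly_bounded_succ F : poly_bounded F -> poly_bounded (fun n => (F n).+1).
Proof.
case=> p pF; exists (p + 1%:P)%R => n.
by rewrite hornerD hornerC natrDE addn1 ltnS.
Qed.

Lemma poly_bounded_exp F k :
  poly_bounded F -> poly_bounded (fun n => F n ^ k).
Proof.
move=> pF; elim: k => [|k IH]; first exact: poly_bounded_const.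
have [p Hp] := poly_bounded_mul pF IH.
by exists p => n; rewrite expnS.
Qed.

(** * Ranking bounded multisets of numbers *)

Section MultisetRank.
Context (k n : nat).
Implicit Types M N P : seq nat.

(* The multiset order on multisets of numbers in [1, n]; occurrences of 0 are
   not counted, so that multisets of size at most k can be padded to k-tuples. *)
Definition mset_lt M N : bool :=
  [exists v : 'I_n.+1, [&& 0 < v,
     count_mem (v : nat) M < count_mem (v : nat) N
   & [forall w : 'I_n.+1, (v < w) ==>
        (count_mem (w : nat) M == count_mem (w : nat) N)]]].

(** Converts the multiset order into a number at most [n.+1 ^ k], which will bound the length of a
    chain of recursive calls. *)
Definition mset_rank N : nat :=
  #|[set m : k.-tuple 'I_n.+1 | mset_lt [seq val i | i <- m] N]|.

Lemma mset_lt_irr M : mset_lt M M = false.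
Proof. by apply/existsP => -[v]; rewrite ltnn andbF. Qed.

Lemma mset_lt_trans N M P : mset_lt M N -> mset_lt N P -> mset_lt M P.
Proof.
move=> /existsP[v /and3P[v0 vMN /forallP vw]] /existsP[v' /and3P[v'0 vNP /forallP v'w]].
apply/existsP; case: (ltngtP v v') => vv'.
- exists v'; rewrite v'0 (eqP (implyP (vw v') vv')) vNP /=.
  apply/forallP => w; apply/implyP => lt_w.
  by rewrite (eqP (implyP (vw w) (ltn_trans vv' lt_w))) (implyP (v'w w)).
- exists v; rewrite v0 -(eqP (implyP (v'w v) vv')) vMN /=.
  apply/forallP => w; apply/implyP => lt_w.
  by rewrite (eqP (implyP (vw w) lt_w)) (implyP (v'w w)) // (ltn_trans vv').
- move: (val_inj vv') => evv'; rewrite -evv' in v'0 vNP v'w.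
  exists v; rewrite v0 (ltn_trans vMN vNP) /=.
  apply/forallP => w; apply/implyP => lt_w.
  by rewrite (eqP (implyP (vw w) lt_w)) (implyP (v'w w)).
Qed.

Lemma eq_mset_lt M M' N :
  (forall v, 0 < v -> count_mem v M = count_mem v M') ->
  mset_lt M N = mset_lt M' N.
Proof.
move=> eM; apply: eq_existsb => v; case: (ltnP 0 v) => //= v0.
rewrite eM //; congr (_ && _); apply: eq_forallb => w.
by case: (ltnP v w) => //= vw; rewrite eM // (ltn_trans v0).
Qed.

(** By transitivity everything below [M] is below [N]. The inclusion is strict because [M] itself,
    padded to a [k]-tuple, is below [N] but not below [M]. *)
Lemma mset_rank_lt M N :
  size M <= k -> (forall x, x \in M -> x <= n) ->
  mset_lt M N -> mset_rank M < mset_rank N.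
Proof.
move=> sM Mn MN; apply: proper_card; rewrite properE; apply/andP; split.
  by apply/subsetP => m; rewrite !inE => mM; apply: mset_lt_trans MN.
(* The padding uses zeros, which [mset_lt] does not count. *)
pose m := [seq inord x : 'I_n.+1 | x <- M ++ nseq (k - size M) 0].
have sm : size m == k by rewrite size_map size_cat size_nseq subnKC.
have vm : [seq val i | i <- m] = M ++ nseq (k - size M) 0.
  rewrite -map_comp -[RHS]map_id; apply/eq_in_map => x /=.
  rewrite mem_cat => xM; apply: inordK; rewrite ltnS.
  case/orP: xM => [/Mn //|]; by rewrite mem_nseq => /andP[_ /eqP ->].
have em P : mset_lt [seq val i | i <- Tuple sm] P = mset_lt M P.
  apply: eq_mset_lt => v v0 /=; rewrite vm count_cat count_nseq /=.
  by rewrite eq_sym -[v == 0]negbK -lt0n v0 mul0n addn0.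
by apply/subsetPn; exists (Tuple sm); rewrite !inE em ?mset_lt_irr.
Qed.

Lemma mset_rank_le N : mset_rank N <= n.+1 ^ k.
Proof. by rewrite -{1}(card_ord n.+1) -card_tuple max_card. Qed.

End MultisetRank.

(** * From the multiset extension of an order to multisets of depths *)

Section MultisetExtension.
Context (T : eqType) (gt eqv : T -> T -> Prop).
Implicit Types M N : seq T.

Lemma pairwise_eqv_mem Z W y :
  pairwise_eqv eqv Z W -> y \in W -> exists2 x, x \in Z & eqv x y.
Proof.
elim=> // x z X Y exz _ IH; rewrite inE => /orP[/eqP ->|/IH[x' x'X ex'y]].
  by exists x; rewrite ?mem_head.
by exists x' => //; rewrite inE x'X orbT.
Qed.

Lemma mul_ge_mem M N y :
  mul_ge gt eqv M N -> y \in N -> exists2 x, x \in M & gt x y \/ eqv x y.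
Proof.
move=> [X [Y [Z [W [eM eN ZW XY]]]]]; rewrite (perm_mem eN) mem_cat.
case/orP=> [/XY[x xX gxy]|/(pairwise_eqv_mem ZW)[x xZ exy]]; exists x.
- by rewrite (perm_mem eM) mem_cat xX.
- by left.
- by rewrite (perm_mem eM) mem_cat xZ orbT.
- by right.
Qed.

Lemma mul_gtW M N : mul_gt gt eqv M N -> mul_ge gt eqv M N.
Proof. by move=> [X [Y [Z [W [_ ? ? ? ?]]]]]; exists X, Y, Z, W. Qed.

Lemma ex_argmax (f : T -> nat) (X : seq T) :
  X <> [::] -> exists2 x, x \in X & forall y, y \in X -> f y <= f x.
Proof.
elim: X => // x [|x' X] IH _.
  by exists x; rewrite ?mem_head // => y; rewrite inE => /eqP ->.
have [//|z zX zmax] := IH.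
case: (leqP (f x) (f z)) => xz.
  exists z; first by rewrite inE zX orbT.
  by move=> y; rewrite inE => /orP[/eqP -> //|]; apply: zmax.
exists x; rewrite ?mem_head // => y; rewrite inE => /orP[/eqP -> //|yX].
by apply: leq_trans (zmax y yX) (ltnW xz).
Qed.

(** Take [x] in the replaced part [X] with [f x] maximal. All of [Y] lies strictly below [f x], so
    this value occurs more often in [M] than in [N]; above it only the matched parts [Z] and [W]
    contribute, and they have the same values. *)
Lemma mul_gt_mset_lt (f : T -> nat) n M N :
  (forall x, x \in M -> 0 < f x <= n) ->
  (forall x y, x \in M -> gt x y -> f y < f x) ->
  (forall x y, x \in M -> eqv x y -> f x = f y) ->
  mul_gt gt eqv M N -> mset_lt n [seq f x | x <- N] [seq f x | x <- M].
Proof.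
move=> fM fgt feq [X [Y [Z [W [X0 eM eN ZW XY]]]]].
have XM x : x \in X -> x \in M by rewrite (perm_mem eM) mem_cat => ->.
have ZM x : x \in Z -> x \in M by rewrite (perm_mem eM) mem_cat orbC => ->.
have eZW : [seq f x | x <- Z] = [seq f x | x <- W].
  elim: ZW ZM => //= x y X' Y' exy _ IH ZM'.
  rewrite (feq x y) ?IH // => [z zX|]; apply: ZM'; rewrite inE ?eqxx //.
  by rewrite zX orbT.
have [x xX xmax] := ex_argmax f X0.
have /andP[x0 xn] := fM x (XM x xX).
have Yx y : y \in Y -> f y < f x.
  move=> /XY[z zX gzy]; apply: leq_trans (xmax z zX).
  by apply: fgt gzy; apply: XM.
have cM v : count_mem v [seq f x | x <- M] =
    count_mem v [seq f x | x <- X] + count_mem v [seq f x | x <- W].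
  by rewrite (permP (perm_map f eM)) map_cat count_cat eZW.
have cN v : count_mem v [seq f x | x <- N] =
    count_mem v [seq f x | x <- Y] + count_mem v [seq f x | x <- W].
  by rewrite (permP (perm_map f eN)) map_cat count_cat.
have cY v : f x <= v -> count_mem v [seq f x | x <- Y] = 0.
  move=> xv; apply/count_memPn/mapP => -[y yY ev].
  by have := Yx y yY; rewrite -ev ltnNge xv.
apply/existsP; exists (Ordinal (xn : f x < n.+1)) => /=.
rewrite x0 cM cN cY // -[X in X < _]addn0 addnC ltn_add2r -has_count has_pred1 map_f //=.
apply/forallP => w; apply/implyP => xw; rewrite cM cN cY 1?ltnW //.
rewrite eqn_add2r eq_sym; apply/eqP/count_memPn/mapP => -[y yX ew].
by have := xmax y yX; rewrite -ew leqNgt xw.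
Qed.

End MultisetExtension.

(** * Depth, values and substitutions *)

Section Terms.
Context {V : countType} {S : signature}.
Implicit Types (s t : term V S) (sigma tau : V -> term V S).

(* Avoids reasoning on equalities of dependent pairs. *)
Lemma App_transport (P : forall f : S, args V S f -> Prop)
    f (a : args V S f) g (b : args V S g) :
  App g b = App f a -> P f a -> P g b.
Proof.
move=> e Pa.
by change (match App g b with App f a => P f a | Var _ => True end); rewrite e.
Qed.

Lemma depth_gt0 t : 0 < depth t. Proof. by case: t. Qed.

Lemma depth_App_leP f (a : args V S f) h :
  reflect (forall i, depth (a i) <= h) (depth (App f a) <= h.+1).
Proof.
by apply: (iffP (bigmax_leqP _ _ _)) => leh i; [apply: leh | move=> _; apply: leh].
Qed.

Lemma depth_arg f (a : args V S f) i : depth (a i) < depth (App f a).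
Proof. by move: i; apply/depth_App_leP. Qed.

Lemma depth_le_tsize t : depth t <= Defs.tsize t.
Proof.
elim: t => // f a IH; apply/depth_App_leP => i.
by apply: leq_trans (IH i) _; rewrite (bigD1 i) //= leq_addr.
Qed.

Lemma terms_over_App (G : {set S}) f (a : args V S f) :
  terms_over G (App f a) = (f \in G) && [forall i, terms_over G (a i)].
Proof.
rewrite /terms_over /= subUset sub1set; congr (_ && _).
by apply/bigcupsP/forallP => [H i|H i _]; apply: H.
Qed.

Lemma value_App f (a : args V S f) :
  value (App f a) = (f \notin defined S) && [forall i, value (a i)].
Proof. by rewrite /value terms_over_App inE. Qed.

Lemma eq_subst sigma tau t :
  (forall x, occurs x t -> sigma x = tau x) -> subst sigma t = subst tau t.
Proof.
elim: t => [x|f a IH] /= e; first by apply: e.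
congr App; apply/ffunP => i; rewrite !ffunE; apply: IH => x xi.
by apply: e; apply/existsP; exists i.
Qed.

Lemma depth_subst_arg sigma f (a : args V S f) i :
  depth (subst sigma (a i)) < depth (subst sigma (App f a)).
Proof. by have := depth_arg [ffun i => subst sigma (a i)] i; rewrite ffunE. Qed.

End Terms.

(** * Cost and result depth of innermost evaluation *)

Section InnermostRewriting.
Context {V : countType} {S : signature} (R : trs V S).
Implicit Types (s t u : term V S).

(** The [match] on the term gives access to the arguments without equations between dependent pairs;
    the later inversion lemmas have the same form. *)
Lemma rstep_inv s u : rstep R s u ->
  (exists l r sigma, [/\ (l, r) \in R, s = subst sigma l & u = subst sigma r]) \/
  match s with
  | App f a => exists i t, rstep R (a i) t
  | Var _ => False
  end.
Proof.
case=> [l r sigma lr|f a i t st]; first by left; exists l, r, sigma.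
by right; exists i, t.
Qed.

Lemma istep_inv s u : istep R s u ->
  match s with
  | App f a =>
     (forall i, normal_form R (a i)) /\
       (exists l r sigma, [/\ (l, r) \in R, subst sigma l = App f a & u = subst sigma r])
     \/ (exists i t, istep R (a i) t /\ u = App f (replace_arg a i t))
  | Var _ => False
  end.
Proof.
case=> [l r sigma f a lr e nf|f a i t st]; last by right; exists i, t.
by left; split=> //; exists l, r, sigma.
Qed.

Lemma istep_rstep s u : istep R s u -> rstep R s u.
Proof.
elim=> [l r sigma f a lr <- _|f a i t _ st]; first exact: rstep_root.
exact: rstep_arg.
Qed.

Lemma normal_form_arg f (a : args V S f) i :
  normal_form R (App f a) -> normal_form R (a i).
Proof. by move=> nf u st; apply: (nf (App f (replace_arg a i u))); apply: rstep_arg. Qed.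

Lemma normal_form_subst_occurs sigma t x :
  normal_form R (subst sigma t) -> occurs x t -> normal_form R (sigma x).
Proof.
elim: t => [y|f a IH] /= nf; first by move/eqP ->.
case/existsP => i; apply: IH.
by have := normal_form_arg (i := i) nf; rewrite ffunE.
Qed.

(** The depth is controlled at normal forms only: arguments are fully evaluated before the root is
    contracted, so intermediate depths never matter. *)
Definition bounded s (c d : nat) : Prop :=
  forall n u, iderivation R n s u -> n <= c /\ (normal_form R u -> depth u <= d).

Lemma bounded_le s c d c' d' :
  c <= c' -> d <= d' -> bounded s c d -> bounded s c' d'.
Proof.
move=> cc' dd' Bs n u /Bs[nc ud]; split; first exact: leq_trans cc'.
by move=> /ud ud'; apply: leq_trans dd'.
Qed.

Lemma bounded_normal_form s d :
  normal_form R s -> depth s <= d -> bounded s 0 d.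
Proof.
by move=> nf sd [|n] u /= => [<- //|[t st _]]; case: (nf t); apply: istep_rstep.
Qed.

Lemma bounded_step s t c d :
  istep R s t -> bounded s c d -> 0 < c /\ bounded t c.-1 d.
Proof.
move=> st Bs; have /Bs[c0 _] : iderivation R 1 s t by exists t.
split=> // n u tu; have /Bs[nc ud] : iderivation R n.+1 s u by exists t.
by split=> //; rewrite -ltnS prednK.
Qed.

(** Induction on the length of the derivation. A step inside argument [i] is charged to [ci i]; the
    first root step finds all arguments normal and of depth at most [di], and the rest is charged to
    [c]. *)
Lemma bounded_App f (a : args V S f) (ci di : 'I_(arity f) -> nat) c d :
  (forall i, bounded (a i) (ci i) (di i)) ->
  (forall b : args V S f, (forall i, normal_form R (b i)) ->
     (forall i, depth (b i) <= di i) -> bounded (App f b) c d) ->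
  bounded (App f a) (\sum_i ci i + c) d.
Proof.
move=> Ba Bf n; elim: n a ci Ba => [|n IH] a ci Ba u.
  move=> /= <-; split=> // nf.
  have nfa i : normal_form R (a i) by apply: normal_form_arg nf.
  have da i : depth (a i) <= di i by have [_] := Ba i 0 _ erefl; apply.
  by have [_] := Bf a nfa da 0 _ erefl; apply.
case=> s1 /[dup] st /istep_inv[[nfa _] su|[i [t [ait ->]]] su].
  have da i : depth (a i) <= di i by have [_] := Ba i 0 _ erefl; apply.
  have [|nc ud] := Bf a nfa da n.+1 u; first by exists s1.
  by split=> //; apply: leq_trans nc (leq_addl _ _).
have [ci0 Bt] := bounded_step ait (Ba i).
(* The step just made uses up one unit of the budget of argument [i]. *)
pose ci' j := if j == i then (ci i).-1 else ci j.
have [|nc ud] := IH (replace_arg a i t) ci' _ u su.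
  by move=> j; rewrite ffunE /ci'; case: eqP => [->|].
split=> //; move: nc; rewrite -ltnS => /leq_trans; apply.
rewrite -addSn leq_add2r.
rewrite (bigD1 i) //= [X in _ <= X](bigD1 i) //= /ci' eqxx -addSn prednK //.
by rewrite leq_add2l; apply: leq_sum => j /negbTE ->.
Qed.

(** The term may already be a normal form, hence the separate bound on its own depth. *)
Lemma bounded_root f (a : args V S f) c d :
  (forall i, normal_form R (a i)) -> depth (App f a) <= d ->
  (forall l r sigma, (l, r) \in R -> subst sigma l = App f a ->
     bounded (subst sigma r) c d) ->
  bounded (App f a) c.+1 d.
Proof.
move=> nfa da Br [|n] u /=; first by move=> <-.
case=> s1 /istep_inv[[_ [l [r [sigma [lr el ->]]]]]|[i [t [ait _]]]].
  by move=> /(Br l r sigma lr el)[].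
by case: (nfa i t); apply: istep_rstep.
Qed.

Context (R_cons : constructor_trs R).

Lemma normal_form_constructor f (a : args V S f) :
  f \notin defined S -> (forall i, normal_form R (a i)) -> normal_form R (App f a).
Proof.
move=> fc nfa u /rstep_inv[[l [r [sigma [lr e _]]]]|[i [t st]]]; last exact: nfa st.
have [] := R_cons lr; case: l e {lr} => //= g p e _ _ /andP[gD _].
have : g \notin defined S by apply: (App_transport (P := fun g _ => g \notin _) (esym e)).
by rewrite gD.
Qed.

Lemma normal_form_Var x : normal_form R (Var x).
Proof.
move=> u /rstep_inv[[l [r [sigma [lr e _]]]]|//].
by have [] := R_cons lr; case: l e {lr}.
Qed.

Lemma normal_form_subst_value sigma t :
  (forall x, normal_form R (sigma x)) -> value t -> normal_form R (subst sigma t).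
Proof.
move=> nf; elim: t => [x|f a IH] /=; first by move=> _; apply: nf.
rewrite value_App => /andP[fc /forallP va]; apply: normal_form_constructor => // i.
by rewrite ffunE; apply: IH.
Qed.

Lemma normal_form_value t : value t -> normal_form R t.
Proof.
elim: t => [x _|f a IH]; first exact: normal_form_Var.
rewrite value_App => /andP[fc /forallP va]; apply: normal_form_constructor => // i.
exact: IH.
Qed.

(* Variables that do not occur in the left-hand side can be left untouched, so
   one may assume a substitution that is normalised everywhere. *)
Lemma normalised_matcher f (p : args V S f) r sigma :
  (App f p, r) \in R ->
  (forall i, normal_form R (subst sigma (p i))) ->
  exists tau, [/\ forall x, normal_form R (tau x),
    subst tau (App f p) = subst sigma (App f p) & subst tau r = subst sigma r].
Proof.
move=> lr nf; pose tau x := if occurs x (App f p) then sigma x else Var x.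
exists tau; split.
- move=> x; rewrite /tau; case: ifP => [/= /existsP[i xi]|_]; last exact: normal_form_Var.
  exact: normal_form_subst_occurs (nf i) xi.
- by apply: eq_subst => x xl; rewrite /tau xl.
- have [_ rl _] := R_cons lr.
  by apply: eq_subst => x /rl xl; rewrite /tau xl.
Qed.

End InnermostRewriting.

(** * The path orders on values *)

Section PathOrder.
Context {V : countType} {S : signature} (prec : rel S) (safe : safe_assignment S).
Context (prec_adm : admissible prec).
Implicit Types (s t : term V S) (sigma : V -> term V S).

Lemma aux_gt_inv s t : aux_gt prec safe s t ->
  match s with
  | App f a =>
    (exists2 i, f \in defined S -> i \notin safe f &
       aux_gt prec safe (a i) t \/ safe_eq prec safe (a i) t) \/
    match t with
    | App g b => [/\ f \in defined S, prec_gt prec f g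
                   & forall i, aux_gt prec safe (App f a) (b i)]
    | Var _ => False
    end
  | Var _ => False
  end.
Proof. by case=> [f a i {}t fi H|f a g b *]; [left; exists i | right]. Qed.

Lemma pop_inv s t : pop prec safe s t ->
  match s with
  | App f a =>
    (exists i, pop prec safe (a i) t \/ safe_eq prec safe (a i) t) \/
    f \in defined S /\
    match t with
    | App g b =>
      [/\ prec_gt prec f g,
          forall j, j \notin safe g -> aux_gt prec safe (App f a) (b j),
          forall j, j \in safe g -> pop prec safe (App f a) (b j)
        & #|[set j in safe g
            | ~~ terms_over (down prec (Fun (App f a))) (b j)]| <= 1] \/
      [/\ prec_eq prec f g,
          mul_gt (pop prec safe) (safe_eq prec safe) (normal_args safe a) (normal_args safe b)
        & mul_ge (pop prec safe) (safe_eq prec safe) (safe_args safe a) (safe_args safe b)]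
    | Var _ => False
    end
  | Var _ => False
  end.
Proof.
case=> [f a i {}t H|f a g b *|f a g b *]; first by left; exists i.
  by right; split=> //; left.
by right; split=> //; right.
Qed.

Lemma safe_eq_value s t : safe_eq prec safe s t -> value s -> value t.
Proof.
elim=> // f g a b pi efg [pi' _ piK] _ IH _; rewrite !value_App.
case/andP=> fc /forallP va; rewrite -(prec_adm.1 f g) // fc; apply/forallP => i.
by rewrite -(piK i); apply: IH.
Qed.

Lemma safe_eq_depth sigma s t :
  safe_eq prec safe s t -> depth (subst sigma s) = depth (subst sigma t).
Proof.
elim=> // f g a b pi efg bpi _ IH _ /=; congr _.+1.
rewrite [RHS](reindex pi) /=; last by apply: onW_bij.
by apply: eq_bigr => i _; rewrite !ffunE.
Qed.

(** The root of a value is not defined, so only the subterm clause applies: [t] is safely equivalent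
    to a proper subterm of [s], and safe equivalence preserves depth under substitution. *)
Lemma pop_value sigma s t : value s -> pop prec safe s t ->
  value t /\ depth (subst sigma t) < depth (subst sigma s).
Proof.
elim: s t => [x|f a IH] t; first by move=> _ /pop_inv.
rewrite value_App => /andP[fc /forallP va] /pop_inv[[i]|[fD]]; last by rewrite fD in fc.
case=> [/(IH i t (va i))[vt lt_t]|e]; split=> //.
- exact: ltn_trans lt_t (depth_subst_arg _ _ _).
- exact: safe_eq_value e (va i).
- by rewrite -(safe_eq_depth sigma e) depth_subst_arg.
Qed.

Lemma aux_gt_value sigma s t : value s -> aux_gt prec safe s t ->
  value t /\ depth (subst sigma t) < depth (subst sigma s).
Proof.
elim: s t => [x|f a IH] t; first by move=> _ /aux_gt_inv.
rewrite value_App => /andP[fc /forallP va] /aux_gt_inv[[i _]|]; last first.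
  by case: t => // g b [fD]; rewrite fD in fc.
case=> [/(IH i t (va i))[vt lt_t]|e]; split=> //.
- exact: ltn_trans lt_t (depth_subst_arg _ _ _).
- exact: safe_eq_value e (va i).
- by rewrite -(safe_eq_depth sigma e) depth_subst_arg.
Qed.

Lemma mem_normal_args f (a : args V S f) x :
  reflect (exists2 i, i \notin safe f & x = a i) (x \in normal_args safe a).
Proof.
by apply: (iffP mapP) => -[i ii ->]; exists i => //; move: ii; rewrite mem_enum inE.
Qed.

Lemma mem_safe_args f (a : args V S f) x :
  reflect (exists2 i, i \in safe f & x = a i) (x \in safe_args safe a).
Proof.
by apply: (iffP mapP) => -[i ii ->]; exists i => //; move: ii; rewrite mem_enum.
Qed.

End PathOrder.

(** * The polynomial bounds *)

(* Bounds for the evaluation of an instance of a right-hand side of depth at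
   most h, when the symbols occurring in it cost c and add d to the depth, and
   the normal arguments of the left-hand side have depth at most N. *)
Fixpoint rhs_depth (d : nat -> nat) (h N : nat) : nat :=
  if h is h'.+1 then d (rhs_depth d h' N) + rhs_depth d h' N else N.

Fixpoint rhs_cost (K : nat) (c d : nat -> nat) (h N : nat) : nat :=
  if h is h'.+1 then K * rhs_cost K c d h' N + c (rhs_depth d h' N) else 0.

(** The pair at [L] serves defined symbols with fewer than [L] symbols strictly below them. The
    factor [(N.+1 ^ K).+1] bounds the number of nested recursive calls, each of which pays for one
    root step and one right-hand side. At level 0 the value 1 for the depth accounts for a
    constructor. *)
Fixpoint level_bounds (K H L : nat) : (nat -> nat) * (nat -> nat) :=
  if L is L'.+1 then
    let: (c, d) := level_bounds K H L' in
    (fun N => (N.+1 ^ K).+1 * (rhs_cost K c d H N).+1,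
     fun N => (N.+1 ^ K).+1 * (rhs_depth d H N).+1)
  else (fun=> 0, fun=> 1).

Lemma leq_rhs_depth d h N : N <= rhs_depth d h N.
Proof. by elim: h => //= h IH; apply: leq_trans IH (leq_addl _ _). Qed.

Lemma poly_bounded_rhs_depth d h : poly_bounded d -> poly_bounded (rhs_depth d h).
Proof.
move=> pd; elim: h => [|h IH] /=; first exact: poly_bounded_id.
by apply: poly_bounded_add => //; apply: poly_bounded_comp.
Qed.

Lemma poly_bounded_rhs_cost K c d h :
  poly_bounded c -> poly_bounded d -> poly_bounded (rhs_cost K c d h).
Proof.
move=> pc pd; elim: h => [|h IH] /=; first exact: poly_bounded_const.
apply: poly_bounded_add; first exact: poly_bounded_mul (poly_bounded_const K) IH.
exact: poly_bounded_comp pc (poly_bounded_rhs_depth h pd).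
Qed.

Lemma poly_bounded_level_bounds K H L :
  poly_bounded (level_bounds K H L).1 /\ poly_bounded (level_bounds K H L).2.
Proof.
elim: L => [|L /=]; first by split; apply: poly_bounded_const.
case: (level_bounds K H L) => c d [/= pc pd].
have pK : poly_bounded (fun N => (N.+1 ^ K).+1).
  by apply/poly_bounded_succ/poly_bounded_exp/poly_bounded_succ/poly_bounded_id.
split; apply: poly_bounded_mul => //; apply: poly_bounded_succ.
  exact: poly_bounded_rhs_cost.
exact: poly_bounded_rhs_depth.
Qed.

(** * Evaluation bounds along the precedence *)

Section Evaluation.
Context {V : countType} {S : signature} (R : trs V S).
Context (prec : rel S) (safe : safe_assignment S).
Context (R_cons : constructor_trs R) (prec_adm : admissible prec).
Context (K : nat) (arity_le : forall g : S, arity g <= K).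

Definition symbol_bounded (c d : nat -> nat) (g : S) : Prop :=
  forall N M (b : args V S g),
    (forall i, normal_form R (b i)) ->
    (forall i, i \notin safe g -> depth (b i) <= N) ->
    (forall i, i \in safe g -> depth (b i) <= M) ->
    bounded R (App g b) (c N) (d N + M).

Section RightHandSide.
Context (c d : nat -> nat) (f : S) (p : args V S f) (sigma : V -> term V S).
Context (N M X Y : nat).
Let s := App f p.
Hypothesis f_def : f \in defined S.
Hypothesis p_value : forall i, value (p i).
Hypothesis sigma_nf : forall x, normal_form R (sigma x).
Hypothesis p_normal : forall i, i \notin safe f -> depth (subst sigma (p i)) <= N.
Hypothesis p_safe : forall i, i \in safe f -> depth (subst sigma (p i)) <= M.
Hypothesis lower_bounded : forall g, prec_gt prec f g -> symbol_bounded c d g.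
Hypothesis rec_bounded : forall g (b : args V S g), prec_eq prec f g ->
  mul_gt (pop prec safe) (safe_eq prec safe) (normal_args safe p) (normal_args safe b) ->
  mul_ge (pop prec safe) (safe_eq prec safe) (safe_args safe p) (safe_args safe b) ->
  bounded R (subst sigma (App g b)) X (Y + M).

Lemma bounded_value t e :
  value t -> depth (subst sigma t) <= e -> bounded R (subst sigma t) 0 e.
Proof.
move=> vt te; apply: bounded_normal_form => //.
exact: normal_form_subst_value.
Qed.

(** As [f] is defined, the auxiliary order reaches only normal arguments of [s], so neither bound
    involves [M]. *)
Lemma aux_gt_bounded h t : depth t <= h -> aux_gt prec safe s t ->
  bounded R (subst sigma t) (rhs_cost K c d h N) (rhs_depth d h N).
Proof.
elim: h t => [|h IH] t th; first by move: (depth_gt0 t); rewrite ltnNge th.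
case/aux_gt_inv => [[i /(_ f_def) nfi it]|].
  have [vt ti] : value t /\ depth (subst sigma t) <= depth (subst sigma (p i)).
    case: it => [/(aux_gt_value prec_adm sigma (p_value i))[vt /ltnW]|e] //.
    by rewrite (safe_eq_depth sigma e); split=> //; apply: safe_eq_value e _.
  apply: bounded_le (bounded_value vt (leqnn _)) => //.
  apply: leq_trans ti (leq_trans (p_normal nfi) _).
  exact: (leq_rhs_depth _ h.+1).
case: t th => // g b /depth_App_leP bh [_ fg bg].
set e := rhs_depth d h N; set k := rhs_cost K c d h N.
(* All arguments of [g], normal and safe alike, evaluate to depth at most [e]; hence [e] plays both
   roles in [lower_bounded]. *)
apply: (@bounded_le _ _ _ _ (\sum_(i < arity g) k + c e) (d e + e)) => //.
  by rewrite sum_nat_const card_ord leq_add2r leq_mul2r arity_le orbT.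
apply: (bounded_App (di := fun=> e)) => [i|b' nfb' db'].
  by rewrite ffunE; apply: IH.
exact: lower_bounded.
Qed.

(* [X] and [Y] account for the recursive call: there is at most one in [t],
   and none if all symbols of [t] lie below those of [s]. *)
Lemma pop_bounded h t : depth t <= h -> pop prec safe s t ->
  let rc : nat := ~~ terms_over (down prec (Fun s)) t in
  bounded R (subst sigma t) (rhs_cost K c d h N + rc * X)
    (rhs_depth d h N + rc * Y + M).
Proof.
elim: h t => [|h IH] t th; first by move: (depth_gt0 t); rewrite ltnNge th.
case/pop_inv => [[i it]|[_]].
  have [vt ti] : value t /\ depth (subst sigma t) <= depth (subst sigma (p i)).
    case: it => [/(pop_value prec_adm sigma (p_value i))[vt /ltnW]|e] //.
    by rewrite (safe_eq_depth sigma e); split=> //; apply: safe_eq_value e _.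
  apply: bounded_le (bounded_value vt (leqnn _)) => //.
  apply: leq_trans ti _; have := leq_rhs_depth d h.+1 N.
  by case: (boolP (i \in safe f)) => [/p_safe|/p_normal]; lia.
case: t th => // g b /depth_App_leP bh [[fg nb sb rb]|[fg nb sb]]; last first.
  have [hD hC] := prec_adm.
  have gD : g \in defined S by rewrite -(hD f g).
  suff -> : terms_over (down prec (Fun s)) (App g b) = false.
    by apply: bounded_le (rec_bounded fg nb sb); lia.
  (* No symbol of [s] is strictly above [g]: [f] is equivalent to [g], and the other symbols of [s]
     are constructors, which by admissibility do not dominate the defined symbol [g]. *)
  apply/negbTE; rewrite terms_over_App negb_and inE; apply/orP; left.
  apply/existsP => -[f' /andP[]]; rewrite /s /= inE => /orP[|/bigcupP[i _ f'i]].
    move/set1P => ->; rewrite /prec_gt; case/andP: fg => _ ->.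
    by rewrite andbF.
  by apply/negP; apply: hC => //; have /subsetP/(_ _ f'i) := p_value i; rewrite inE.
set e := rhs_depth d h N; set k := rhs_cost K c d h N => rc.
(* [ri i] charges the recursive call to the safe argument containing it. The sum is at most 1 by the
   cardinality condition of the order, and 0 when [t] has only symbols below those of [s]. *)
pose ri i : nat := (i \in safe g) && ~~ terms_over (down prec (Fun s)) (b i).
have ri_rc : \sum_i ri i <= rc.
  have -> : \sum_i ri i =
      #|[set j in safe g | ~~ terms_over (down prec (Fun s)) (b j)]|.
    by rewrite -sum1_card [RHS]big_mkcond; apply: eq_bigr => i _; rewrite inE /ri; case: (_ && _).
  rewrite /rc; case: (boolP (terms_over _ _)) => //=.
  rewrite terms_over_App => /andP[_ /forallP tb]; rewrite leqn0 cards_eq0.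
  by apply/eqP/setP => i; rewrite !inE tb andbF.
pose di i := if i \in safe g then e + rc * Y + M else e.
apply: (@bounded_le _ _ _ _ (\sum_i (k + ri i * X) + c e) (d e + (e + rc * Y + M))).
- rewrite big_split /= sum_nat_const card_ord -big_distrl /= -/e -/k.
  rewrite addnAC; apply: leq_add; last by rewrite leq_mul2r ri_rc orbT.
  by rewrite leq_add2r leq_mul2r arity_le orbT.
- by rewrite /= -/e !addnA.
apply: (bounded_App (di := di)) => [i|b' nfb' db'].
  rewrite ffunE /di; case: ifP => isafe.
    have := IH (b i) (bh i) (sb i isafe); cbv zeta; rewrite -/e -/k.
    have -> : ~~ terms_over (down prec (Fun s)) (b i) = ri i :> nat by rewrite /ri isafe.
    apply: bounded_le => //; rewrite leq_add2r leq_add2l leq_mul2r.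
    by apply/orP; right; apply: leq_trans ri_rc; rewrite (bigD1 i) //= leq_addr.
  apply: bounded_le (aux_gt_bounded (bh i) (nb i _)); rewrite ?isafe //.
  exact: leq_addr.
by apply: lower_bounded => // i isafe; have := db' i; rewrite /di ?isafe ?(negbTE isafe).
Qed.

End RightHandSide.

Lemma normal_args_subst sigma f (p : args V S f) :
  normal_args safe [ffun i => subst sigma (p i)] =
  [seq subst sigma t | t <- normal_args safe p].
Proof. by rewrite /normal_args -map_comp; apply: eq_map => i /=; rewrite ffunE. Qed.

Lemma size_normal_args f (a : args V S f) : size (normal_args safe a) <= K.
Proof.
rewrite size_map -cardE; apply: leq_trans (max_card _) _.
by rewrite card_ord.
Qed.

Definition args_rank (N : nat) f (a : args V S f) : nat :=
  mset_rank K N [seq depth t | t <- normal_args safe a].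

Context (H : nat) (rhs_le : forall l r, (l, r) \in R -> depth r <= H).
Context (R_pop : forall l r, (l, r) \in R -> pop prec safe l r).
Context (prec_trans : transitive prec).

(** * Recursion among equivalent symbols *)

Section Recursion.
Context (c d : nat -> nat) (f0 : S) (N : nat).
Hypothesis lower_bounded : forall g, prec_gt prec f0 g -> symbol_bounded c d g.

(** Strong induction on [k]. One root step and the nonrecursive part of the right-hand side cost at
    most [A.+1]; the recursive call, if any, has rank below [k] and costs at most [k * A.+1]. The
    depth is counted in the same way with [E.+1]. *)
Lemma rank_bounded k f (a : args V S f) M :
  f \in defined S -> prec_eq prec f0 f -> args_rank N a <= k ->
  (forall i, normal_form R (a i)) ->
  (forall i, i \notin safe f -> depth (a i) <= N) ->
  (forall i, i \in safe f -> depth (a i) <= M) ->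
  bounded R (App f a) (k.+1 * (rhs_cost K c d H N).+1)
    (k.+1 * (rhs_depth d H N).+1 + M).
Proof.
set A := rhs_cost _ _ _ _ _; set E := rhs_depth _ _ _.
have [adm1 _] := prec_adm.
elim/ltn_ind: k f a => k IHk f a fD f0f ak nfa aN aM.
have NE : N <= E by apply: leq_rhs_depth.
apply: (@bounded_le _ _ _ _ (A + k * A.+1).+1 (k.+1 * E.+1 + M)) => //.
apply: bounded_root => // [|l r sigma lr el].
  (* The extra unit in [E.+1] absorbs the root symbol [f]. *)
  apply: (@leq_trans (maxn N M).+1); last by rewrite mulSn; move: NE; clear; lia.
  apply/depth_App_leP => i; rewrite leq_max.
  by case: (boolP (i \in safe f)) => [/aM|/aN] ->; rewrite ?orbT.
have lr_pop := R_pop lr; have [] := R_cons lr.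
case: l el lr_pop lr => // g p el lr_pop lr _ _ /andP[gD /forallP vp].
move: fD f0f ak nfa aN aM.
pose P f (a : args V S f) := f \in defined S -> prec_eq prec f0 f ->
  args_rank N a <= k -> (forall i, normal_form R (a i)) ->
  (forall i, i \notin safe f -> depth (a i) <= N) ->
  (forall i, i \in safe f -> depth (a i) <= M) ->
  bounded R (subst sigma r) (A + k * A.+1) (k.+1 * E.+1 + M).
apply: (App_transport (P := P) (esym el)) => {f a el} _ f0g ak nfa aN aM.
have [|tau [nft el er]] := normalised_matcher R_cons (sigma := sigma) lr.
  by move=> i; have := nfa i; rewrite ffunE.
pose Q g (a : args V S g) := args_rank N a <= k /\
  (forall i, i \notin safe g -> depth (a i) <= N) /\
  (forall i, i \in safe g -> depth (a i) <= M).
have [{}ak [{}aN {}aM]] : Q g [ffun i => subst tau (p i)].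
  exact: (App_transport (P := Q) el).
rewrite -er {er el nfa}.
have pN i : i \notin safe g -> depth (subst tau (p i)) <= N.
  by move=> /aN; rewrite ffunE.
have pM i : i \in safe g -> depth (subst tau (p i)) <= M.
  by move=> /aM; rewrite ffunE.
have lower g' : prec_gt prec g g' -> symbol_bounded c d g'.
  case/andP=> gg' g'g; apply: lower_bounded; case/andP: f0g => f0g gf0.
  rewrite /prec_gt (prec_trans f0g gg') /=; apply: contra g'g => g'f0.
  exact: prec_trans g'f0 f0g.
pose rc : nat := ~~ terms_over (down prec (Fun (App g p))) r.
have rc1 : rc <= 1 by rewrite /rc; case: (terms_over _ _).
(* The allowances for the recursive call are [X := k * A.+1] and [Y := k * E.+1]. *)
apply: (@bounded_le _ _ _ _ (A + rc * (k * A.+1)) (E + rc * (k * E.+1) + M)).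
- by rewrite leq_add2l -[X in _ <= X]mul1n leq_mul2r rc1 orbT.
- rewrite leq_add2r mulSn addSn leqW // leq_add2l.
  by rewrite -[X in _ <= X]mul1n leq_mul2r rc1 orbT.
apply: pop_bounded (rhs_le lr) lr_pop => // g' b gg' nb sb.
have g'D : g' \in defined S by rewrite -(adm1 g g').
have f0g' : prec_eq prec f0 g'.
  case/andP: f0g gg' => f0g gf0 /andP[gg' g'g].
  by rewrite /prec_eq (prec_trans f0g gg') (prec_trans g'g gf0).
pose dt t := depth (subst tau t).
have val_le x y : value x -> pop prec safe x y \/ safe_eq prec safe x y ->
    value y /\ dt y <= dt x.
  move=> vx [/(pop_value prec_adm tau vx)[vy /ltnW]|e] //; split.
    exact: safe_eq_value e vx.
  by rewrite /dt (safe_eq_depth tau e).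
have nb_le i : i \notin safe g' -> value (b i) /\ dt (b i) <= N.
  move=> ni; have /(mul_ge_mem (mul_gtW nb))[x] : b i \in normal_args safe b.
    by apply/mem_normal_args; exists i.
  case/mem_normal_args => j nj -> /(val_le _ _ (vp j))[vb le_b]; split=> //.
  exact: leq_trans le_b (pN j nj).
have sb_le i : i \in safe g' -> value (b i) /\ dt (b i) <= M.
  move=> ni; have /(mul_ge_mem sb)[x] : b i \in safe_args safe b.
    by apply/mem_safe_args; exists i.
  case/mem_safe_args => j nj -> /(val_le _ _ (vp j))[vb le_b]; split=> //.
  exact: leq_trans le_b (pM j nj).
have rk : args_rank N [ffun i => subst tau (b i)] < k.
  apply: leq_trans ak; apply: mset_rank_lt.
  - by rewrite size_map size_normal_args.
  - move=> x; rewrite normal_args_subst -(map_comp depth (subst tau)) => /mapP[t /mem_normal_args[i ni ->] ->].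
    by have [] := nb_le i ni.
  rewrite !normal_args_subst -!(map_comp depth (subst tau)).
  refine (mul_gt_mset_lt (f := dt) _ _ _ nb) => [x|x y|x y] /mem_normal_args[i ni ->].
  - by rewrite depth_gt0 pN.
  - by move=> /(pop_value prec_adm tau (vp i))[].
  - exact: safe_eq_depth.
(* A recursive call has rank strictly below [k], so [k] is positive, and the induction hypothesis at
   [k.-1] gives exactly the allowances [X] and [Y]. *)
have k0 : 0 < k by apply: leq_ltn_trans rk.
have -> : k = k.-1.+1 by rewrite prednK.
apply: IHk => //.
- by rewrite prednK.
- by rewrite -ltnS prednK.
- move=> i; rewrite ffunE; apply: normal_form_subst_value => //.
  by case: (boolP (i \in safe g')) => [/sb_le|/nb_le] [].
- by move=> i /nb_le[_]; rewrite ffunE.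
- by move=> i /sb_le[_]; rewrite ffunE.
Qed.

End Recursion.

Context (safe_cons : safe_mapping safe) (prec_refl : reflexive prec).

(** All positions of a constructor are safe, so its root adds just 1 to [M], and [d N] covers this
    unit. *)
Lemma constructor_bounded c d g :
  g \notin defined S -> (forall N, 0 < d N) -> symbol_bounded c d g.
Proof.
move=> gC d0 N M b nfb _ bM.
have := bounded_normal_form (normal_form_constructor R_cons gC nfb) (leqnn _).
apply: bounded_le => //; apply: (@leq_trans M.+1); last by have := d0 N; lia.
by apply/depth_App_leP => i; apply: bM; rewrite safe_cons.
Qed.

Definition level (f : S) : nat := #|[set g | prec_gt prec f g]|.

Lemma level_gt f g : prec_gt prec f g -> level g < level f.
Proof.
move=> fg; case/andP: (fg) => pfg ngf; apply: proper_card; rewrite properE.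
apply/andP; split; last first.
  by apply/subsetPn; exists g; rewrite inE // /prec_gt prec_refl.
apply/subsetP => h; rewrite !inE => /andP[gh nhg].
rewrite /prec_gt (prec_trans pfg gh) /=; apply: contra nhg => hf.
exact: prec_trans hf pfg.
Qed.

Lemma level_bounds_gt0 L N : 0 < (level_bounds K H L).2 N.
Proof. by case: L => //= L; case: (level_bounds K H L). Qed.

(** Defined symbols below [f] have smaller level and constructors are bounded at any level, so
    [rank_bounded] applies with [k] the largest possible rank [N.+1 ^ K]. *)
Lemma level_symbol_bounded L f : f \in defined S -> level f < L ->
  symbol_bounded (level_bounds K H L).1 (level_bounds K H L).2 f.
Proof.
elim: L f => // L IH f fD; rewrite ltnS => fL.
have lower g : prec_gt prec f g ->
    symbol_bounded (level_bounds K H L).1 (level_bounds K H L).2 g.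
  move=> fg; case: (boolP (g \in defined S)) => gD.
    by apply: IH => //; apply: leq_trans (level_gt fg) fL.
  by apply: constructor_bounded => // N; apply: level_bounds_gt0.
move: lower => /=; case: (level_bounds K H L) => c d /= lower N M b nfb bN bM.
apply: (rank_bounded lower) => //; first by rewrite /prec_eq prec_refl.
exact: mset_rank_le.
Qed.

End Evaluation.

(** * Uniform bounds and runtime complexity *)

Section Signature.
Context {V : countType} {S : signature} (R : trs V S).

Definition max_arity : nat := \max_(g : S) arity g.
Definition max_rhs : nat := \max_(lr <- R) depth lr.2.
(** The level of a symbol is at most [#|S|] for every precedence, so this bound is uniform in the
    precedence and the safe mapping. *)
Definition runtime_bound : nat -> nat :=
  (level_bounds max_arity max_rhs #|S|.+1).1.

Lemma basic_bounded prec safe f (a : args V S f) :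
  constructor_trs R -> pop_instance R prec safe -> basic (App f a) ->
  forall n u, iderivation R n (App f a) u -> n <= runtime_bound (normal_depth safe a).
Proof.
move=> Rc [[pr pt] adm sm Rpop] /andP[fD /forallP va] n u su.
have ar (g : S) : arity g <= max_arity by apply: (leq_bigmax_cond (P := predT)).
have rh (l r : term V S) : (l, r) \in R -> depth r <= max_rhs.
  by move=> lr; rewrite /max_rhs (big_rem _ lr) leq_max leqnn.
have fL : level prec f < #|S|.+1 by rewrite ltnS max_card.
have := level_symbol_bounded Rc adm ar rh Rpop pt sm pr fD fL.
(* Any bound on the safe arguments will do for [M], since the cost depends on the normal depth
   alone; the depth of the whole term is one. *)
move/(_ (normal_depth safe a) (depth (App f a)) a).
case/(_ _ _ _ n u su) => // i.
- by apply: normal_form_value.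
- exact: (leq_bigmax_cond (P := fun i => i \notin safe f)).
- by move=> _; apply/ltnW/depth_arg.
Qed.

Lemma is_dheight_Var x h :
  constructor_trs R -> is_dheight R (Var x : term V S) h -> h = 0.
Proof.
move=> Rc [_ [[t]|[_ //]]]; case: h => //= h [u /istep_rstep st _].
by case: (normal_form_Var Rc st).
Qed.

End Signature.

Theorem theorem3p7 (V : countType) (hV : infinite_type V) (S : signature)
    (R : trs V S) (hR : predicative_recursive R) :
  (exists p : {poly nat},
     forall (prec : rel S) (safe : safe_assignment S),
       pop_instance R prec safe ->
       forall (f : S) (a : args V S f),
         basic (App f a) ->
         exists2 h : nat,
           is_dheight R (App f a) h & h <= (p.[normal_depth safe a])%R) /\
  (exists q : {poly nat},
     forall n : nat, exists2 m : nat, is_rc R n m & m <= (q.[n])%R).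
Proof.
have [Rc [prec [safe inst]]] := hR.
have [p Hp] : poly_bounded (runtime_bound R).
  by have [pc _] := poly_bounded_level_bounds (@max_arity S) (max_rhs R) #|S|.+1; apply: pc.
have dh prec' safe' : pop_instance R prec' safe' -> forall f (a : args V S f),
    basic (App f a) -> forall n u, iderivation R n (App f a) u ->
    n <= (p.[normal_depth safe' a])%R.
  move=> inst' f a ba n u su; apply: leq_trans (Hp _).
  exact: basic_bounded Rc inst' ba n u su.
split; exists p.
  by move=> prec' safe' inst' f a ba; apply: ex_is_max => n [u]; apply: (dh _ _ inst' _ _ ba).
move=> n.
have [|m Hm mp] := @ex_is_max (fun h => exists t : term V S,
    [/\ basic t, Defs.tsize t <= n & is_dheight R t h]) (p.[n])%R.
  move=> h [[x|f a] [bt tn ht]]; first by rewrite (is_dheight_Var Rc ht).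
  (* The height is either attained by a derivation, to which the bound applies, or 0. The normal
     depth is then at most the size, and the polynomial is monotone. *)
  case: ht => _ [[u su]|[_ -> //]]; apply: leq_trans (dh _ _ inst _ _ bt _ _ su) _.
  apply: leq_horner; apply: leq_trans tn; apply: leq_trans (depth_le_tsize _).
  by apply/bigmax_leqP => i _; apply/ltnW/depth_arg.
(* It remains to show that every basic term has a derivation height, which follows from the bounds
   on derivation lengths. *)
exists m => //; split=> // -[x|f a] bt _.
  have [|h ? _] := @ex_is_max (fun k => exists t, iderivation R k (Var x : term V S) t) 0.
    move=> [//|k] [t [u /istep_rstep st _]].
    by case: (normal_form_Var Rc st).
  by exists h.
have [|h ? _] := @ex_is_max (fun k => exists t, iderivation R k (App f a) t)
  (p.[normal_depth safe a])%R; last by exists h.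
by move=> k [t]; apply: (dh _ _ inst _ _ bt).
Qed.
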